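(* Let $m,n$ be positive integers and let $\mathcal{C}$ be a symmetric Cauchy tensor of order $m$ and dimension $n$ with generating vector $c\in\mathbb{R}^n$. Then $\mathcal{C}$ is centrosymmetric if and only if $c$ is symmetric, i.e. $Jc=c$.
   Context: Write $[n]=\{1,\dots,n\}$. Given $c=(c_1,\dots,c_n)\in\mathbb{R}^n$ with $c_{i_1}+\cdots+c_{i_m}\ne0$ for all $i_1,\dots,i_m\in[n]$, the (symmetric) Cauchy tensor of order $m$ and dimension $n$ with generating vector $c$ is the real tensor $\mathcal{C}=(c_{i_1\cdots i_m})$ with entries $c_{i_1i_2\cdots i_m}=\dfrac{1}{c_{i_1}+c_{i_2}+\cdots+c_{i_m}}$. A tensor $(a_{i_1\cdots i_m})$ of order $m$ and dimension $n$ is centrosymmetric if $a_{i_1\cdots i_m}=a_{n-i_1+1,\dots,n-i_m+1}$ for all indices in $[n]$. $J$ is the $n\times n$ matrix with $J_{ij}=\delta_{i,\,n-j+1}$, so $(Jc)_i=c_{n-i+1}$. *)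

(* Defs.v *)
From HB Require Import structures.
From mathcomp Require Import all_boot all_order all_algebra.
From mathcomp Require Import reals.

Set Implicit Arguments.
Unset Strict Implicit.
Unset Printing Implicit Defensive.

Import Order.TTheory GRing.Theory Num.Theory.
Local Open Scope ring_scope.

(* The index set [n] = {1, ..., n} is 'I_n, numbered from 0; [rev_ord], which
   sends i to n - i.+1, is then the map i |-> n - i + 1 of the 1-based
   numbering. *)

Definition tensor (R : realType) (m n : nat) := {ffun m.-tuple 'I_n -> R}.

Definition index_sum (R : realType) (m n : nat) (c : 'cV[R]_n)
    (i : m.-tuple 'I_n) : R :=
  \sum_(k < m) c (tnth i k) 0.

Definition is_cauchy_tensor (R : realType) (m n : nat) (c : 'cV[R]_n)
    (C : tensor R m n) : Prop :=
  (forall i : m.-tuple 'I_n, index_sum c i != 0) /\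
  (forall i : m.-tuple 'I_n, C i = 1 / index_sum c i).

Definition centrosymmetric (R : realType) (m n : nat) (A : tensor R m n) :
    Prop :=
  forall i : m.-tuple 'I_n, A i = A (map_tuple (@rev_ord n) i).

Definition exchange_mx (R : realType) (n : nat) : 'M[R]_n :=
  \matrix_(i < n, j < n) (i == rev_ord j)%:R.

Definition symmetric_vec (R : realType) (n : nat) (c : 'cV[R]_n) : Prop :=
  exchange_mx R n *m c = c.

(* Main.v *)
Require Import Defs.
From mathcomp Require Import all_boot all_order all_algebra.
From mathcomp Require Import reals.

Import GRing.Theory Num.Theory.

(** Inverting an entry recovers its index sum, so centrosymmetry says that reversing all indices
    preserves index sums. On constant tuples ([index_sum_nseq]) this reads m c_i = m c_(n-i+1),
    which is Jc = c by [symmetric_vecP]; conversely, a symmetric [c] makes the sums agree term by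
    term. *)

Lemma exchange_mxE (R : realType) (n : nat) (c : 'cV[R]_n) (i : 'I_n) :
  (exchange_mx R n *m c)%R i 0%R = c (rev_ord i) 0%R.
Proof.
rewrite mxE (bigD1 (rev_ord i)) //= mxE rev_ordK eqxx mul1r big1 ?addr0 //.
(* Applying the involution [rev_ord] to both sides turns the test [i == rev_ord j] into one that
   [jNi] refutes. *)
move=> j jNi; rewrite mxE -(inj_eq rev_ord_inj) rev_ordK eq_sym.
by rewrite (negbTE jNi) mul0r.
Qed.

Lemma symmetric_vecP (R : realType) (n : nat) (c : 'cV[R]_n) :
  symmetric_vec c <-> forall i, c (rev_ord i) 0%R = c i 0%R.
Proof.
split=> [sym_c i | rev_c]; first by rewrite -exchange_mxE sym_c.
by apply/matrixP => i j; rewrite ord1 exchange_mxE.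
Qed.

Lemma index_sum_nseq (R : realType) (m n : nat) (c : 'cV[R]_n) (i : 'I_n) :
  index_sum c (nseq_tuple m i) = (c i 0 *+ m)%R.
Proof.
rewrite /index_sum; under eq_bigr do rewrite tnth_nseq.
by rewrite sumr_const card_ord.
Qed.

Theorem theorem5p1 (R : realType) (m n : nat) (hm : (0 < m)%N) (hn : (0 < n)%N)
    (c : 'cV[R]_n) (C : tensor R m n) (hC : is_cauchy_tensor c C) :
  centrosymmetric C <-> symmetric_vec c.
Proof.
case: hC => _ CE; rewrite symmetric_vecP; split=> [centro i | rev_c t].
  (* Compare the diagonal entries [1 / (m * c_i)]. *)
  have := centro (nseq_tuple m i).
  have -> : map_tuple (@rev_ord n) (nseq_tuple m i) = nseq_tuple m (rev_ord i).
    by apply: val_inj; rewrite /= map_nseq.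
  (* Inversion is injective on all of [R] (0^-1 is 0), and [hm] allows cancelling the factor [m]. *)
  by rewrite !CE !index_sum_nseq !div1r => /invr_inj /(pmulrnI hm) ->.
suff sum_rev : index_sum c (map_tuple (@rev_ord n) t) = index_sum c t.
  by rewrite !CE sum_rev.
by apply: eq_bigr => k _; rewrite tnth_map rev_c.
Qed.
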